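(* For every integer $s\ge 2$, the maximum length (number of edges) of a path graph that is isomorphic to $\mathcal{G}(w)$ for some nonempty word $w$ over $\Sigma_s$ is $3s-3$.
   Context: $\Sigma_s$ denotes the ordered alphabet $\{a_1<a_2<\dots<a_s\}$. For a nonempty word $w=w_1\cdots w_n$ over $\Sigma_s$, the Parikh graph $\mathcal{G}(w)$ is the simple undirected graph on $\{1,\dots,n\}$ where, for $i<j$, $i$ and $j$ are adjacent iff $w_i=a_k$ and $w_j=a_{k+1}$ for some $1\le k\le s-1$. A path graph of length $m$ is a path on $m+1$ vertices (with $m$ edges). *)

(* Defs.v *)
From mathcomp Require Import all_boot.

Set Implicit Arguments.
Unset Strict Implicit.
Unset Printing Implicit Defensive.

(* A finite simple graph is a symmetric irreflexive relation on a finType.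
   The letter a_(k+1) of the ordered alphabet with s letters is k : 'I_s, and
   the positions 1, ..., n of a word w are the elements 0, ..., n - 1 of
   'I_(size w). *)

Definition letter_at (s : nat) (w : seq 'I_s) (i : 'I_(size w)) : 'I_s :=
  tnth (in_tuple w) i.

Definition parikh_arc (s : nat) (w : seq 'I_s) : rel 'I_(size w) :=
  fun i j => (i < j) && (letter_at j == (letter_at i).+1 :> nat).

Definition parikh_graph (s : nat) (w : seq 'I_s) : rel 'I_(size w) :=
  fun i j => parikh_arc i j || parikh_arc j i.

Lemma parikh_graph_sym (s : nat) (w : seq 'I_s) : symmetric (@parikh_graph s w).
Proof. by move=> i j; rewrite /parikh_graph orbC. Qed.

Lemma parikh_graph_irr (s : nat) (w : seq 'I_s) :
  irreflexive (@parikh_graph s w).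
Proof. by move=> i; rewrite /parikh_graph /parikh_arc ltnn. Qed.

(* The length m counts edges, so there are m + 1 vertices. *)
Definition path_graph (m : nat) : rel 'I_m.+1 :=
  fun i j => (j == i.+1 :> nat) || (i == j.+1 :> nat).

Lemma path_graph_sym (m : nat) : symmetric (@path_graph m).
Proof. by move=> i j; rewrite /path_graph orbC. Qed.

Lemma path_graph_irr (m : nat) : irreflexive (@path_graph m).
Proof.
move=> i; rewrite /path_graph orbb; apply/negbTE.
by rewrite neq_ltn ltnSn.
Qed.

Definition graph_iso (T U : finType) (e : rel T) (f : rel U) : Prop :=
  exists2 h : T -> U, bijective h & forall x y, e x y = f (h x) (h y).

Definition is_maximum (P : nat -> Prop) (M : nat) : Prop :=
  P M /\ forall m, P m -> m <= M.

(* Main.v *)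
Require Import Defs.
From mathcomp Require Import all_boot.
From mathcomp Require Import zify.

(** Upper bound: for i < j and i' < j' with i, i' carrying a_k and j, j'
    carrying a_(k+1), either i < j' or i' < j, so the edges of the Parikh graph
    between two consecutive letters contain no induced 2K_2.  In a path this
    confines the edges of each of the s - 1 levels to three consecutive ones.

    Lower bound: give the vertex 3q + r of the path the letter q, q + 1 or q
    (counted from 0) according to whether r = 0, 1 or 2, and write all vertices
    with r = 2, then all with r = 0, then all with r = 1, each block by
    decreasing q. *)

Set Implicit Arguments.
Unset Strict Implicit.

(** The map [i |-> c i * d + i %% d] into [n * d] values is injective: equal images give the same
    fiber and the same residue mod [d], and indices of one fiber differ by less than [d]. *)
Lemma leq_spread_fibers (d m n : nat) (c : nat -> nat) :
  (forall i, i < m -> c i < n) ->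
  (forall i j, i < m -> j < m -> c i = c j -> j < i + d) ->
  m <= n * d.
Proof.
move=> c_lt c_near; case: (posnP m) => [-> // | m_gt0].
have d_gt0 : 0 < d by have := c_near 0 0 m_gt0 m_gt0 erefl.
have f_lt (i : 'I_m) : c i * d + i %% d < n * d.
  have := c_lt i (ltn_ord i); have := ltn_pmod i d_gt0; nia.
rewrite -[leqLHS]card_ord -[leqRHS]card_ord.
apply: (@leq_card _ _ (fun i => Ordinal (f_lt i))) => i j /(congr1 val) /= eq_f.
have eq_mod : i = j %[mod d].
  by have := congr1 (modn^~ d) eq_f; rewrite !modnMDl !modn_mod.
have eq_c : c i = c j.
  by apply/eqP; rewrite -(eqn_pmul2r d_gt0) -(eqn_add2r (i %% d)) eq_f eq_mod.
have lt_ji := c_near _ _ (ltn_ord i) (ltn_ord j) eq_c.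
have lt_ij := c_near _ _ (ltn_ord j) (ltn_ord i) (esym eq_c).
apply/val_inj => /=; move: eq_mod; case/orP: (leq_total i j) => le_ij.
  move/esym/eqP; rewrite eqn_mod_dvd // => /dvdn_leq; lia.
move/eqP; rewrite eqn_mod_dvd // => /dvdn_leq; lia.
Qed.

Section ParikhLevels.

Variables (s : nat) (w : seq 'I_s).
Implicit Types x y : 'I_(size w).

Definition edge_level x y : nat := minn (letter_at x) (letter_at y).

Lemma edge_level_lt x y : parikh_graph x y -> edge_level x y < s.-1.
Proof.
rewrite /parikh_graph /parikh_arc /edge_level.
have := ltn_ord (letter_at x); have := ltn_ord (letter_at y); lia.
Qed.

Lemma edge_level_arc x y : parikh_arc x y ->
  (edge_level x y = letter_at x) * (edge_level y x = letter_at x).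
Proof.
case/andP=> _ /eqP lxy; rewrite /edge_level lxy.
by split; [apply/minn_idPl | apply/minn_idPr].
Qed.

(** Failure of both arcs would give [y' <= x < y <= x' < y']. *)
Lemma parikh_arc_2K2_free x y x' y' :
  parikh_arc x y -> parikh_arc x' y' -> letter_at x = letter_at x' :> nat ->
  parikh_arc x y' || parikh_arc x' y.
Proof.
rewrite /parikh_arc => /andP[lt_xy /eqP->] /andP[lt_xy' /eqP->] ->.
rewrite eqxx !andbT; lia.
Qed.

Lemma parikh_graph_2K2_free x y x' y' :
  parikh_graph x y -> parikh_graph x' y' -> edge_level x y = edge_level x' y' ->
  [|| parikh_graph x x', parikh_graph x y', parikh_graph y x'
    | parikh_graph y y'].
Proof.
rewrite /parikh_graph.
case/orP=> xy /orP[] xy'; rewrite (edge_level_arc xy) (edge_level_arc xy').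
all: by move/(parikh_arc_2K2_free xy xy')/orP => [] ->; rewrite ?orbT.
Qed.

Lemma path_length_bound (m : nat) :
  graph_iso (@path_graph m) (@parikh_graph s w) -> m <= 3 * s - 3.
Proof.
case=> h _ h_iso; have -> : 3 * s - 3 = s.-1 * 3 by lia.
pose c i := edge_level (h (inord i)) (h (inord i.+1)).
have edge (i : nat) : i < m -> parikh_graph (h (inord i)) (h (inord i.+1)).
  by move=> lt_im; rewrite -h_iso /path_graph !inordK ?eqxx //; lia.
apply: (@leq_spread_fibers 3 m s.-1 c) => [i lt_im | i j lt_im lt_jm eq_c].
  exact/edge_level_lt/edge.
(* Some vertex of [{i, i+1}] is a path neighbour of one of [{j, j+1}], whence [j <= i + 2]. *)
have := parikh_graph_2K2_free (edge i lt_im) (edge j lt_jm) eq_c.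
rewrite -!h_iso /path_graph !inordK; lia.
Qed.

End ParikhLevels.

Section ExtremalWord.

Variable n : nat.

(** The blocks r = 2, 0, 1 have lengths [n], [n.+1], [n]; the middle one is longer because the path
    ends at vertex [3 * n]. *)
Definition extremal_letter (p : nat) : nat :=
  if p < n then n.-1 - p else if p <= 2 * n then 2 * n - p else (3 * n).+1 - p.

Definition extremal_word : seq 'I_n.+1 :=
  mkseq (fun p => inord (extremal_letter p)) (3 * n).+1.

Definition path_position (t : nat) : nat :=
  if t %% 3 == 0 then 2 * n - t %/ 3
  else if t %% 3 == 1 then 3 * n - t %/ 3
  else n.-1 - t %/ 3.

Lemma letter_at_extremal (i : 'I_(size extremal_word)) :
  letter_at i = extremal_letter i :> nat.
Proof.
have := ltn_ord i; rewrite [ltnRHS]size_mkseq => lt_i.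
rewrite /letter_at (tnth_nth ord0) nth_mkseq // inordK //.
rewrite /extremal_letter; do 2?case: ifP; lia.
Qed.

Lemma path_position_lt (t : 'I_(3 * n).+1) : path_position t < size extremal_word.
Proof.
rewrite size_mkseq /path_position; have := ltn_ord t; do 2?case: ifP; lia.
Qed.

Lemma path_position_inj (t u : 'I_(3 * n).+1) :
  path_position t = path_position u -> t = u.
Proof.
move=> eq_tu; apply/val_inj; move: eq_tu; rewrite /path_position /=.
have := ltn_ord t; have := ltn_ord u; do 4?case: ifP; lia.
Qed.

Lemma extremal_letter_position (t : nat) : t <= 3 * n ->
  extremal_letter (path_position t) = t %/ 3 + (t %% 3 == 1).
Proof. rewrite /extremal_letter /path_position; do 4?case: ifP; lia. Qed.

(** Letters decrease within a block, so arcs only lead to later blocks. First to middle gives the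
    edges 3q+2, 3q+3; first to last 3q+2, 3q+1; middle to last 3q, 3q+1. *)
Lemma extremal_word_path :
  graph_iso (@path_graph (3 * n)) (@parikh_graph n.+1 extremal_word).
Proof.
exists (fun t => Ordinal (path_position_lt t)).
  apply: inj_card_bij => [t u /(congr1 val) | ]; first exact: path_position_inj.
  by rewrite !card_ord size_mkseq.
move=> t u; rewrite /parikh_graph /parikh_arc /path_graph !letter_at_extremal /=.
rewrite !extremal_letter_position -1?ltnS // /path_position.
have := ltn_ord t; have := ltn_ord u; do 4?case: ifP; lia.
Qed.

End ExtremalWord.

Theorem theorem5p6 (s : nat) (hs : 2 <= s) :
  is_maximum
    (fun m : nat => exists w : seq 'I_s,
       w <> [::] /\ graph_iso (@path_graph m) (@parikh_graph s w))
    (3 * s - 3).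
Proof.
split=> [|m [w [_]]]; last exact: path_length_bound.
case: s hs => // n _; rewrite mulnS addKn.
by exists (extremal_word n); split; last exact: extremal_word_path.
Qed.
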